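(* If $I$ is an uncountable set, then the real Banach space $\ell_1(I)$ does not have the $c_0$-extension property.
   Context: A Banach space $X$ has the $c_0$-extension property if every bounded linear operator $T:Y\to c_0$ defined on a closed subspace $Y$ of $X$ admits a bounded linear extension $\tilde T:X\to c_0$. *)

(* Defs.v *)
From HB Require Import structures.
From mathcomp Require Import all_boot all_order all_algebra finmap.
From mathcomp Require Import all_classical all_reals all_analysis.

Set Implicit Arguments.
Unset Strict Implicit.
Unset Printing Implicit Defensive.

Import Order.TTheory GRing.Theory Num.Theory.
Import numFieldNormedType.Exports.

Local Open Scope classical_set_scope.
Local Open Scope ring_scope.

Section subspace_type.
Variables (R : numFieldType) (X : normedModType R) (Y : submodClosed X).

Record subspace_type := SubspaceType { subspace_val :> X; _ : subspace_val \in Y }.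

HB.instance Definition _ := [isSub for subspace_val].
HB.instance Definition _ := [Choice of subspace_type by <:].
HB.instance Definition _ := [SubChoice_isSubLmodule of subspace_type by <:].

Let norm (y : subspace_type) : R := `|val y|.

Let norm_triangle y z : norm (y + z) <= norm y + norm z.
Proof. exact: ler_normD. Qed.

Let norm_scale (a : R) y : norm (a *: y) = `|a| * norm y.
Proof. exact: normrZ. Qed.

Let norm_eq0 y : norm y = 0 -> y = 0.
Proof. by move=> /normr0_eq0 y0; apply: val_inj. Qed.

HB.instance Definition _ := Lmodule_isNormed.Build R subspace_type
  norm_triangle norm_scale norm_eq0.

End subspace_type.

Section c0.
Variable R : realType.

Definition c0_pred : {pred nat -> R} := [pred u | `[< u @ \oo --> (0 : R) >]].

Record c0 := C0 { c0_seq :> nat -> R; _ : c0_seq \in c0_pred }.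

HB.instance Definition _ := [isSub for c0_seq].
HB.instance Definition _ := [Choice of c0 by <:].

Let c0_submod_closed : submod_closed c0_pred.
Proof.
split=> [|a u v /asboolP u0 /asboolP v0]; apply/asboolP; first exact: cvg_cst.
rewrite -[X in _ --> X](addr0 0) -[X in _ --> X + _](mulr0 a).
by apply: cvgD => //; apply: cvgMr.
Qed.

HB.instance Definition _ := GRing.isSubmodClosed.Build _ _ c0_pred c0_submod_closed.
HB.instance Definition _ := [SubChoice_isSubLmodule of c0 by <:].

Lemma c0_cvg (u : c0) : u n @[n --> \oo] --> (0 : R).
Proof. by case: u => u /= /asboolP. Qed.

Definition c0_norm (u : c0) : R := sup (range (fun n => `|u n|)).

Lemma c0_norm_ub (u : c0) n : `|u n| <= c0_norm u.
Proof.
apply: ub_le_sup; last by exists n.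
have [M [_ uM]] := cvg_seq_bounded (cvgP _ (@c0_cvg u)).
by exists (M + 1) => _ [k _ <-]; apply: uM => //; rewrite ltrDl.
Qed.

Lemma c0_norm_le (u : c0) e : (forall n, `|u n| <= e) -> c0_norm u <= e.
Proof.
by move=> ue; apply: ge_sup => [|_ [n _ <-]//]; exists `|u 0|; exists 0.
Qed.

Let norm_triangle u v : c0_norm (u + v) <= c0_norm u + c0_norm v.
Proof.
apply: c0_norm_le => n; apply: le_trans (ler_normD _ _) _.
by apply: lerD; exact: c0_norm_ub.
Qed.

Let norm_scale_le (a : R) u : c0_norm (a *: u) <= `|a| * c0_norm u.
Proof.
by apply: c0_norm_le => n; rewrite normrM ler_wpM2l// c0_norm_ub.
Qed.

Let norm_scale (a : R) u : c0_norm (a *: u) = `|a| * c0_norm u.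
Proof.
apply/eqP; rewrite eq_le norm_scale_le/=.
have [->|a0] := eqVneq a 0.
  by rewrite normr0 mul0r (le_trans _ (c0_norm_ub _ 0)).
rewrite -ler_pdivlMl ?normr_gt0// -normfV.
by rewrite -{1}(scalerK a0 u) norm_scale_le.
Qed.

Let norm_eq0 u : c0_norm u = 0 -> u = 0.
Proof.
move=> u0; apply/val_inj/funext => n; apply/normr0_eq0/le_anti.
by rewrite normr_ge0 andbT -u0 c0_norm_ub.
Qed.

HB.instance Definition _ := Lmodule_isNormed.Build R c0
  norm_triangle norm_scale norm_eq0.

Lemma c0_normE (u : c0) : `|u| = sup (range (fun n => `|u n|)).
Proof. by []. Qed.

Let complete (F : set_system c0) : ProperFilter F -> cauchy F -> cvg F.
Proof.
move=> FF Fc.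
have cvgF n : cvg ((fun u : c0 => u n) @ F).
  apply: cauchy_cvg; apply/cauchy_exP => e e0.
  have [z Fz] := (cauchyP F).1 Fc _ e0.
  exists (z n).
  suff : F [set u : c0 | ball (z n) e (u n)] by [].
  apply: filterS Fz => u; rewrite -!ball_normE/= => zu.
  exact: le_lt_trans (c0_norm_ub (z - u) n) zu.
pose l n := lim ((fun u : c0 => u n) @ F).
have lz e (z : c0) : F (ball z e) -> forall n, `|z n - l n| <= e.
  move=> Fz n; rewrite distrC.
  have c : `|u n - z n| @[u --> F] --> `|l n - z n|.
    by apply: cvg_norm; apply: cvgB; [exact: cvgF|exact: cvg_cst].
  apply: (cvgr_to_le c).
  suff : F [set u : c0 | `|u n - z n| <= e] by [].
  apply: filterS Fz => u; rewrite -ball_normE/= distrC => uz.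
  exact: ltW (le_lt_trans (c0_norm_ub (u - z) n) uz).
have l0 : l \in c0_pred.
  apply/asboolP/cvgrPdist_le => e e0.
  have e20 : 0 < e / 2 by rewrite divr_gt0.
  have [z Fz] := (cauchyP F).1 Fc _ e20.
  have /cvgrPdist_le/(_ _ e20) := @c0_cvg z.
  apply: filterS => n; rewrite !sub0r !normrN => zn.
  rewrite -[l n](subKr (z n)) (le_trans (ler_normB _ _))// (splitr e).
  by rewrite lerD// lz.
apply/cvg_ex; exists (C0 l0); apply/fcvgrPdist_lt => e e0.
have e20 : 0 < e / 2 by rewrite divr_gt0.
have [z Fz] := (cauchyP F).1 Fc _ e20.
suff : F [set u : c0 | `|C0 l0 - u| < e] by [].
apply: filterS (Fz) => u; rewrite -ball_normE/= => zu.
rewrite -(subrKA z) (le_lt_trans (ler_normD _ _))// (splitr e).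
by rewrite ler_ltD// distrC; apply: c0_norm_le => n; exact: lz.
Qed.

HB.instance Definition _ := Uniform_isComplete.Build c0 complete.

End c0.

Section ell1.
Variables (R : realType) (I : choiceType).

Definition ell1_pred : {pred I -> R} := [pred x | summable setT (EFin \o x)].

Record ell1 := Ell1 { ell1_fun :> I -> R; _ : ell1_fun \in ell1_pred }.

HB.instance Definition _ := [isSub for ell1_fun].
HB.instance Definition _ := [Choice of ell1 by <:].

Let asum (x : I -> R) : \bar R := (\esum_(i in setT) `|x i|%:E)%E.

Let asum_ge0 x : (0 <= asum x)%E.
Proof. by apply: esum_ge0 => i _; rewrite lee_fin. Qed.

Let asumD (x y : I -> R) : (asum (x + y)%R <= asum x + asum y)%E.
Proof.
rewrite -esumD => [|i _|i _]; rewrite ?lee_fin//.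
by apply: le_esum => i _; rewrite -EFinD lee_fin ler_normD.
Qed.

Let asum_leP (x : I -> R) (e : R) :
  (forall A, finite_set A -> \sum_(i <- fset_set A) `|x i| <= e) <->
  (asum x <= e%:E)%E.
Proof.
split=> [h|h A finA].
  apply: ge_ereal_sup => _ [A [finA _] <-].
  by rewrite fsbig_finite//= sumEFin lee_fin h.
rewrite -lee_fin; apply: le_trans h; apply: ereal_sup_ubound.
by exists A => //; rewrite fsbig_finite//= sumEFin.
Qed.

Let asumZ_le (a : R) (x : I -> R) e : (asum x <= e%:E)%E -> (asum (a *: x)%R <= (`|a| * e)%R%:E)%E.
Proof.
move=> /asum_leP h; apply/asum_leP => A finA.
under eq_bigr do rewrite normrM.
by rewrite -mulr_sumr ler_wpM2l// h.
Qed.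

Let ell1_submod_closed : submod_closed ell1_pred.
Proof.
split=> [|a x y xs ys].
  by rewrite inE/= /summable esum1// => i _; rewrite /= normr0.
rewrite inE /summable; apply: le_lt_trans (asumD _ _) _.
apply: lte_add_pinfty => //.
have xfin : asum x \is a fin_num by rewrite ge0_fin_numE.
apply: (@le_lt_trans _ _ (`|a| * fine (asum x))%:E); last exact: ltry.
by apply: asumZ_le; rewrite fineK.
Qed.

HB.instance Definition _ := GRing.isSubmodClosed.Build _ _ ell1_pred ell1_submod_closed.
HB.instance Definition _ := [SubChoice_isSubLmodule of ell1 by <:].

Definition ell1_norm (x : ell1) : R := fine (\esum_(i in setT) `|x i|%:E).

Let asumE (x : ell1) : asum x = (ell1_norm x)%:E.
Proof.
by rewrite /ell1_norm fineK// ge0_fin_numE ?asum_ge0//; case: x.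
Qed.

Lemma ell1_norm_le (x : ell1) e :
  (forall A, finite_set A -> \sum_(i <- fset_set A) `|x i| <= e) <->
  ell1_norm x <= e.
Proof. by rewrite asum_leP asumE lee_fin. Qed.

Lemma ell1_norm_ub (x : ell1) i : `|x i| <= ell1_norm x.
Proof.
have := (ell1_norm_le x _).2 (lexx _) [set i] (finite_set1 i).
by rewrite fset_set1 big_seq_fset1.
Qed.

Let norm_triangle x y : ell1_norm (x + y) <= ell1_norm x + ell1_norm y.
Proof. by rewrite -lee_fin EFinD -!asumE asumD. Qed.

Let norm_scale_le (a : R) x : ell1_norm (a *: x) <= `|a| * ell1_norm x.
Proof. by rewrite -lee_fin -asumE asumZ_le// asumE. Qed.

Let norm_scale (a : R) x : ell1_norm (a *: x) = `|a| * ell1_norm x.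
Proof.
apply/eqP; rewrite eq_le norm_scale_le/=.
have [->|a0] := eqVneq a 0.
  by rewrite normr0 mul0r -lee_fin -asumE.
rewrite -ler_pdivlMl ?normr_gt0// -normfV.
by rewrite -{1}(scalerK a0 x) norm_scale_le.
Qed.

Let norm_eq0 x : ell1_norm x = 0 -> x = 0.
Proof.
move=> x0; apply/val_inj/funext => i; apply/normr0_eq0/le_anti.
by rewrite normr_ge0 andbT -x0 ell1_norm_ub.
Qed.

HB.instance Definition _ := Lmodule_isNormed.Build R ell1
  norm_triangle norm_scale norm_eq0.

Lemma ell1_normE (x : ell1) : `|x| = fine (\esum_(i in setT) `|x i|%:E).
Proof. by []. Qed.

Let complete (F : set_system ell1) : ProperFilter F -> cauchy F -> cvg F.
Proof.
move=> FF Fc.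
have cvgF i : cvg ((fun x : ell1 => x i) @ F).
  apply: cauchy_cvg; apply/cauchy_exP => e e0.
  have [z Fz] := (cauchyP F).1 Fc _ e0.
  exists (z i).
  suff : F [set x : ell1 | ball (z i) e (x i)] by [].
  apply: filterS Fz => x; rewrite -!ball_normE/= => zx.
  exact: le_lt_trans (ell1_norm_ub (z - x) i) zx.
pose l i := lim ((fun x : ell1 => x i) @ F).
have lz e (z : ell1) : F (ball z e) -> (asum (l - val z)%R <= e%:E)%E.
  move=> Fz; apply/asum_leP => A finA.
  have c : (\sum_(i <- fset_set A) `|x i - z i|) @[x --> F] -->
           \sum_(i <- fset_set A) `|l i - z i|.
    apply: cvg_big => [|i _]; first exact: add_continuous.
    apply: cvg_norm.
    by apply: cvgB; [exact: cvgF|exact: cvg_cst].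
  apply: (cvgr_to_le c).
  suff : F [set x : ell1 | \sum_(i <- fset_set A) `|x i - z i| <= e] by [].
  apply: filterS Fz => x; rewrite -ball_normE/= distrC => /ltW xz.
  exact: (ell1_norm_le (x - z) e).2.
have l1 : l \in ell1_pred.
  have [z Fz] := (cauchyP F).1 Fc _ ltr01.
  have : l - val z \in ell1_pred.
    by rewrite inE; apply: le_lt_trans (lz _ _ Fz) _; exact: ltry.
  by move=> /(rpredD (valP z)); rewrite addrC subrK.
apply/cvg_ex; exists (Ell1 l1); apply/fcvgrPdist_lt => e e0.
have e20 : 0 < e / 2 by rewrite divr_gt0.
have [z Fz] := (cauchyP F).1 Fc _ e20.
suff : F [set x : ell1 | `|Ell1 l1 - x| < e] by [].
apply: filterS (Fz) => x; rewrite -ball_normE/= => zx.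
rewrite -(subrKA z) (le_lt_trans (ler_normD _ _))// (splitr e) ler_ltD//.
by rewrite -lee_fin -[X in (X%:E <= _)%E]/(ell1_norm _) -asumE lz.
Qed.

HB.instance Definition _ := Uniform_isComplete.Build ell1 complete.

End ell1.

(* [bounded_fun_norm], being bounded on every ball, is for linear maps the
   existence of M such that |T x| <= M |x| for all x. *)
Definition c0_extension_property (R : realType) (X : completeNormedModType R) :=
  forall Y : submodClosed X, closed [set x : X | x \in Y] ->
  forall T : {linear subspace_type Y -> c0 R}, bounded_fun_norm T ->
  exists2 T' : {linear X -> c0 R},
    bounded_fun_norm T' & forall y : subspace_type Y, T' (val y) = T y.

(* Main.v *)
(* Let J be a set of at most |I| branches x of the binary tree, of size
   aleph_1, chosen so that the finite lists of elements of J can be indexed by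
   I as well: k |-> P k. The branches, as subsets of a countable set, are
   infinite and almost disjoint. Let Q : l1(I) -> l_oo send the unit vector e_k
   to the indicator of the union of the branches in P k, let Y be the preimage
   of c0 under Q, and T = Q on Y. Write k_x for an index with P k_x = [x].
   If P k = [x_1, ..., x_m], without repetitions, then e_k - sum_i e_{k_{x_i}}
   lies in Y because branches are almost disjoint. Hence, if T' extends T, then
   (Q - T') e_k is the sum of the (Q - T') e_{k_{x_i}}: all finite sums of the
   family ((Q - T') e_{k_x})_{x in J} are bounded by 1 + |T'|, so each of its
   countably many coordinates is nonzero for at most countably many x. For
   some x in J therefore (Q - T') e_{k_x} = 0, and the indicator T' e_{k_x} of
   the infinite branch x would be in c0. *)
From HB Require Import structures.
Require Import Defs.
From mathcomp Require Import all_boot all_order all_algebra finmap.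
From mathcomp Require Import all_classical all_reals all_analysis.
From mathcomp Require Import wochoice.
Import Order.TTheory GRing.Theory Num.Theory.
Import numFieldNormedType.Exports.

Local Open Scope classical_set_scope.
Local Open Scope ring_scope.

(** * Coding finite lists of 0-1 sequences by elements of [I] *)

Lemma uncountable_cantor : ~ countable [set: nat -> bool].
Proof.
move=> /countable_injP[f finj].
pose d n := ~~ `[< exists x, f x = n /\ x n >].
have : d (f d) = ~~ d (f d).
  congr (~~ _); apply/asboolP/idP => [[x [fx xd]]|dd]; last by exists d.
  by rewrite -(finj x d _ _ fx) ?inE// fx.
by case: (d _).
Qed.

Lemma uncountable_setC_seq (C : choiceType) (S : set C) :
  ~ countable [set: C] -> countable S ->
  exists f : nat -> C, injective f /\ forall n, ~ S (f n).
Proof.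
move=> Cunc Scnt.
have : infinite_set (~` S).
  move=> /finite_set_countable SCcnt; apply: Cunc.
  rewrite -(setUv S) -bigcup2E; apply: bigcup_countable => //.
  by move=> [|[|n]] _ //=; exact: countable0.
move=> /infiniteP.
elim/choicePpointed: C => C in S Cunc Scnt *.
  by exfalso; apply: Cunc; rewrite emptyE; exact: countable0.
move=> /pcard_leP/unsquash f; exists f; split.
  by move=> m n; apply: inj; rewrite inE.
by move=> n; exact: (@funS _ _ _ _ f n I).
Qed.

(* Transfinite recursion along [lt], at each stage avoiding the countably many
   values already taken. *)
Lemma disjoint_sequences (I C : choiceType) (lt : I -> I -> Prop) :
  well_founded lt -> (forall i j, i <> j -> lt i j \/ lt j i) ->
  ~ countable [set: C] ->
  exists H : I -> nat -> C, forall i j m n,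
    countable [set k | lt k i] -> countable [set k | lt k j] ->
    H i m = H j n -> i = j /\ m = n.
Proof.
move=> wf tot Cunc.
have /choice[sel selP] : forall S : set C, exists f : nat -> C,
    countable S -> injective f /\ forall n, ~ S (f n).
  move=> S; have [Sc|nS] := pselect (countable S).
    by have [f fP] := uncountable_setC_seq C S Cunc Sc; exists f.
  have [f _] := uncountable_setC_seq C set0 Cunc (countable0 _).
  by exists f => /nS.
pose F i (rec : forall k, lt k i -> nat -> C) :=
  sel [set c | exists k (ki : lt k i) n, rec k ki n = c].
pose H := Fix wf (fun=> nat -> C) F.
have HE i : H i = sel [set c | exists k n, lt k i /\ H k n = c].
  (* Unfolding [Fix] needs [F] to be extensional: it sees [rec] only through its set of values. *)
  rewrite {1}/H Fix_eq /F -/F; last first.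
    move=> k f g fg; congr sel; apply/seteqP.
    by split=> c [l [lk [n <-]]]; exists l, lk, n; rewrite fg.
  congr sel; apply/seteqP; split=> c.
    by move=> [k [ki [n <-]]]; exists k, n.
  by move=> [k [n [ki <-]]]; exists k, ki, n.
have HP i : countable [set k | lt k i] ->
    injective (H i) /\ forall k m n, lt k i -> H k m <> H i n.
  move=> icnt; have : countable [set c | exists k n, lt k i /\ H k n = c].
    have := countableX icnt (countableP [set: nat]).
    apply: sub_countable.
    apply: card_le_trans (card_image_le (fun p => H p.1 p.2) _).
    by apply: subset_card_le => c [k [n [ki <-]]]; exists (k, n).
  move=> /selP; rewrite -HE => -[inj av]; split => // k m n ki kE.
  by apply: (av n); exists k, m; rewrite kE.
exists H => i j m n ic jc Hij; have [ij|ij] := pselect (i = j).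
  by subst j; have [inj _] := HP i ic; split => //; exact: inj.
exfalso; have [ij'|ji] := tot _ _ ij; first exact: (HP j jc).2 _ _ _ ij' Hij.
exact: (HP i ic).2 _ _ _ ji (esym Hij).
Qed.

Lemma strict_well_order (I : choiceType) : exists lt : I -> I -> Prop,
  [/\ forall i j k, lt i j -> lt j k -> lt i k,
      forall i j, i <> j -> lt i j \/ lt j i & well_founded lt].
Proof.
have [R Rwo] := well_ordering_principle I.
have Rwc : wo_chain R predT by move=> A _; exact: Rwo.
have anti : antisymmetric R.
  by move=> x y; apply: (wo_chain_antisymmetric Rwc).
have tot : total R by move=> x y; apply: (wo_chainW Rwc).
have min (A : set I) : A !=set0 -> exists z, A z /\ forall x, A x -> R z x.
  move=> [x Ax]; have [|z [[Az zmin] _]] := Rwo (mem A).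
    by exists x; exact: mem_set.
  by exists z; split=> [|y Ay]; [exact: set_mem|apply/zmin/mem_set].
exists (fun i j => ~~ R j i); split.
- move=> i j k ij jk; apply/negP => ki.
  have [|z [zE zmin]] := min [set i; j; k]; first by exists i; left; left.
  move: zE => /= [[]|] zE; subst z.
  + have ik : i = k by apply: anti; rewrite ki zmin //; right.
    by subst k; move: jk; rewrite zmin //; left; right.
  + by move: ij; rewrite zmin //; left; left.
  + by move: jk; rewrite zmin //; left; right.
- move=> i j ij; have [ji|_] := boolP (R j i); last by left.
  by right; apply/negP => /(conj ji)/andP/anti/esym.
- move=> i; apply: contrapT => ni.
  have [|z [nz zmin]] := min [set i | ~ Acc (fun i j => ~~ R j i) i].
    by exists i.
  apply: nz; constructor => j jz; apply: contrapT => /zmin zj.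
  by rewrite zj in jz.
Qed.

(* [J] corresponds to the points of a well-ordering of [I] that have countably
   many predecessors; a list over [J] is then determined by an upper bound and
   a natural number, and such pairs embed in [I]. *)
Lemma uncountable_seq_surj (I : choiceType) : ~ countable [set: I] ->
  exists (J : set (nat -> bool)) (P : I -> seq (nat -> bool)),
    ~ countable J /\ forall s, {in s, forall x, J x} -> exists k, P k = s.
Proof.
move=> Iunc.
have [lt [trans tot wf]] := strict_well_order I.
pose K := [set i | countable [set k | lt k i]].
have Kunc : ~ countable K.
  (* The least [i] outside [K] has all its predecessors in [K], hence countably many, and so lies in
     [K]. *)
  move=> Kcnt; have [i [nKi imin]] : exists i, ~ K i /\ forall k, lt k i -> K k.
    have [i nKi] : exists i, ~ K i.
      apply/existsNP => KT; apply: Iunc; apply: sub_countable Kcnt.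
      by apply: subset_card_le => i _; exact: KT.
    apply: contrapT => nex; elim: (wf i) nKi => {}i _ IH nKi.
    by apply: nex; exists i; split=> // k ki; apply: contrapT; exact: IH.
  by apply: nKi; apply: sub_countable Kcnt; apply: subset_card_le.
(* On [K], [F] at 0 injects points into 0-1 sequences, and [H] injects pairs of a point and an
   integer into [I]. *)
have [F Finj] := disjoint_sequences _ _ _ wf tot uncountable_cantor.
have [H Hinj] := disjoint_sequences _ _ _ wf tot Iunc.
have /choice[e eP] : forall j, exists e : nat -> I, K j ->
    [set k | k = j \/ lt k j] `<=` range e.
  move=> j; have [Kj|] := pselect (K j); last by exists (fun=> j).
  have /countable_injP[f finj] : countable ([set k | k = j \/ lt k j]).
    rewrite (_ : mkset _ = \bigcup_(b in [set: bool])
        if b then [set j] else [set k | lt k j]).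
      by apply: bigcup_countable => // -[] _; [exact: countable1|exact: Kj].
    apply/seteqP; split=> k; first by case; [exists true|exists false].
    by case=> -[] _; [left|right].
  exists (fun n => xget j [set k | (k = j \/ lt k j) /\ f k = n]) => _ k kj.
  exists (f k) => //; case: xgetP => [k' _ [k'j fk]|/(_ k)].
    by apply: finj; rewrite ?inE.
  by case.
(* To decode [k = H j n], read [n] as a list of integers and send each through the enumeration [e j]
   of the points up to [j]; other [k] get the empty list. *)
pose P k := xget [::] [set s | exists j n, [/\ K j, H j n = k &
  s = map (fun i => F (e j i) 0%N) (odflt [::] (choice.unpickle n))]].
exists [set F i 0%N | i in K], P; split.
  move=> Fcnt; apply: Kunc.
  suff /eq_countable<- : ((F^~ 0%N) @` K #= K)%card by [].
  by apply: inj_card_eq => i j /set_mem Ki /set_mem Kj /(Finj _ _ _ _ Ki Kj) [].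
move=> s sK; have [j [Kj [t ->]]] : exists j, K j /\
    exists t, s = map (fun i => F (e j i) 0%N) t.
  have [t tK ->] : exists2 t, {in t, forall i, K i} & s = map (F^~ 0%N) t.
    elim: s sK => [|x s IH] sK; first by exists [::].
    have [|t tK ->] := IH; first by move=> y ys; apply: sK; rewrite inE ys orbT.
    have [i Ki <-] := sK x (mem_head _ _).
    by exists (i :: t) => // j; rewrite inE => /predU1P[->|/tK].
  have [j [Kj jub]] : exists j, K j /\ {in t, forall i, i = j \/ lt i j}.
    elim: t tK => [|i t IH] tK.
      have [j Kj] : K !=set0.
        by apply/set0P/eqP => K0; apply: Kunc; rewrite K0; exact: countable0.
      by exists j.
    have [|j [Kj jub]] := IH; first by move=> y ys; apply: tK; rewrite inE ys orbT.
    have [ij|/tot[ij|ji]] := pselect (i = j).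
    - by exists j; split=> // k; rewrite inE => /predU1P[->|/jub //]; left.
    - by exists j; split=> // k; rewrite inE => /predU1P[->|/jub //]; right.
    - exists i; split; first exact/tK/mem_head.
      move=> k; rewrite inE => /predU1P[->|/jub[->|kj]]; first by left.
        by right.
      by right; exact: trans kj ji.
  exists j; split=> //; elim: t {tK} jub => [|i t IH] jub; first by exists [::].
  have [|u uE] := IH; first by move=> k kt; apply: jub; rewrite inE kt orbT.
  have [n _ en] := eP j Kj i (jub i (mem_head _ _)).
  by exists (n :: u); rewrite /= uE en.
(* By injectivity of [H] on [K], the pair that [xget] finds can only be [j] and
   [choice.pickle t]. *)
exists (H j (choice.pickle t)); rewrite /P; case: xgetP => [s' _|].
  by move=> [j' [n [Kj' /(Hinj _ _ _ _ Kj' Kj)[-> ->] ->]]]; rewrite choice.pickleK.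
move=> /(_ (map (fun i => F (e j i) 0%N) t))[].
by exists j, (choice.pickle t); rewrite choice.pickleK.
Qed.

(** * Branches as almost disjoint infinite sets of integers *)

(* The branch of [x] in the binary tree, the nodes being coded by integers. *)
Definition branch (x : nat -> bool) (n : nat) : bool :=
  if choice.pickle_inv n is Some t then t == mkseq x (size t) else false.

Lemma branchP x n :
  reflect (exists m, n = choice.pickle (mkseq x m)) (branch x n).
Proof.
apply: (iffP idP) => [|[m ->]]; last first.
  by rewrite /branch choice.pickleK_inv size_mkseq.
rewrite /branch; have := @choice.pickle_invK (seq bool) n.
by case: choice.pickle_inv => //= t tn /eqP tE; exists (size t); rewrite -tE tn.
Qed.

Lemma branch_infinite x : infinite_set [set n | branch x n].
Proof.
apply/infiniteP.
have codeI : {in setT &, injective (fun m => choice.pickle (mkseq x m))}.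
  move=> m n _ _ /(pcan_inj choice.pickleK)/(congr1 size).
  by rewrite !size_mkseq.
rewrite -(card_le_eql (inj_card_eq codeI)); apply: subset_card_le.
by move=> _ [m _ <-]; apply/branchP; exists m.
Qed.

(** A common node is a prefix of both sequences, so its length is at most any [k] with [x k <> y k];
    only finitely many prefixes of [x] are that short. *)
Lemma branch_almost_disjoint x y : x <> y ->
  \forall n \near \oo, ~~ (branch x n && branch y n).
Proof.
move=> xy; have [k xyk] : exists k, x k <> y k.
  by apply/existsNP => xyE; apply: xy; exact: funext.
exists (\max_(m < k.+1) choice.pickle (mkseq x m)).+1%N => // n /= nk.
apply/negP => /andP[/branchP[m nE] /branchP[m' nE']].
have mE : mkseq x m = mkseq y m'.
  by apply: (pcan_inj (@choice.pickleK _)); rewrite -nE nE'.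
have mm : m = m' by rewrite -(size_mkseq x m) mE size_mkseq.
subst m'; have [mk|km] := ltnP m k.+1; last first.
  by apply: xyk; rewrite -(nth_mkseq false x km) mE nth_mkseq.
move: nk; rewrite ltnNge => /negP; apply.
rewrite nE; exact: (leq_bigmax (Ordinal mk)).
Qed.

(** By almost disjointness, a large [n] lies on at most one branch of [s]. *)
Lemma has_branch_sum (R : realType) s : uniq s ->
  \forall n \near \oo,
    (has (branch^~ n) s)%:R = \sum_(x <- s) (branch x n)%:R :> R.
Proof.
elim: s => [|x s IH] /=; first by move=> _; near=> n; rewrite big_nil.
move=> /andP[xs us]; have xs' : forall y, y \in s -> x <> y.
  by move=> y ys xy; rewrite xy ys in xs.
have disj : \forall n \near \oo, branch x n -> ~~ has (branch^~ n) s.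
  elim: s {IH us xs} xs' => [|y s IH] xs /=; first by near=> n.
  have xy := branch_almost_disjoint _ _ (xs y (mem_head _ _)).
  have {}IH := IH (fun z zs => xs z (mem_behead (s := y :: s) zs)).
  near=> n => xn; rewrite negb_or; apply/andP; split; last by move: xn; near: n.
  have /negP xyn : ~~ (branch x n && branch y n) by near: n.
  by apply/negP => yn; apply: xyn; rewrite xn.
have {}IH := IH us.
near=> n; rewrite big_cons -(near IH n) //.
have := near disj n _; case: (branch x n) => [/(_ _ isT)/negbTE->//|_] /=.
  by rewrite addr0.
by rewrite add0r.
Unshelve. all: by end_near. Qed.

(** * Sums over subsets of [I] as linear functionals of norm at most 1 on l1 *)

Section ell1_sum.
Variables (R : realType) (I : choiceType).
Implicit Types (x y u v : ell1 R I) (A : I -> bool).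

Lemma ell1_norm_mono x y : (forall i, `|x i| <= `|y i|) -> `|x| <= `|y|.
Proof.
move=> xy; apply/ell1_norm_le => B finB; apply: le_trans (ler_sum _ _) _.
  by move=> i _; exact: xy.
exact: (ell1_norm_le y _).2.
Qed.

Lemma ell1_normD_ge0 x y : (forall i, 0 <= x i) -> (forall i, 0 <= y i) ->
  `|x + y| = `|x| + `|y|.
Proof.
move=> x0 y0; rewrite !ell1_normE -fineD.
- rewrite -esumD => [|i _|i _]; rewrite ?lee_fin//.
  congr fine; apply: eq_esum => i _ /=; rewrite -EFinD.
  by rewrite !ger0_norm //; exact: addr_ge0.
- by have := valP x; rewrite inE summableE.
- by have := valP y; rewrite inE summableE.
Qed.

Lemma ell1_dominated (f : I -> R) x :
  (forall i, `|f i| <= `|x i|) -> f \in @ell1_pred R I.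
Proof.
move=> fx; have := valP x; rewrite !inE; apply: le_lt_trans.
by apply: le_esum => i _; rewrite lee_fin.
Qed.

Lemma ell1_cut_subproof A x i : `|(A i)%:R * x i| <= `|x i|.
Proof. by case: (A i); rewrite ?mul1r// mul0r normr0. Qed.

Lemma ell1_abscut_subproof A x i : `|(A i)%:R * `|x i| | <= `|x i|.
Proof. by case: (A i); rewrite ?mul1r ?normr_id// mul0r normr0. Qed.

Definition ell1_cut A x := Ell1 (ell1_dominated _ _ (ell1_cut_subproof A x)).
Definition ell1_abscut A x :=
  Ell1 (ell1_dominated _ _ (ell1_abscut_subproof A x)).

(* The sum of [x i] over [A]: adding [|x i|] makes the family nonnegative, and
   the sum of a nonnegative family is its norm. *)
Definition ell1_sum A x : R :=
  `|ell1_abscut A x + ell1_cut A x| - `|ell1_abscut A x|.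

(** Moving the subtracted norms across leaves sums of nonnegative families, on which the norm is
    additive. The freedom to choose [u] and [v] is what yields linearity. *)
Lemma ell1_sumE A x u v :
  (forall i, 0 <= u i) -> (forall i, 0 <= v i) ->
  (forall i, (A i)%:R * x i = u i - v i) -> ell1_sum A x = `|u| - `|v|.
Proof.
move=> u0 v0 xE.
have a0 i : 0 <= ell1_abscut A x i by rewrite mulr_ge0 ?ler0n.
have ac0 i : 0 <= (ell1_abscut A x + ell1_cut A x) i.
  by rewrite -[X in 0 <= X]mulrDr mulr_ge0 ?ler0n// -lerBlDr sub0r ler_normr lexx orbT.
apply/eqP; rewrite subr_eq addrAC eq_sym subr_eq -!ell1_normD_ge0 //.
apply/eqP; congr (`| _ |); apply/val_inj/funext => i.
rewrite -[LHS]/(u i + ell1_abscut A x i).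
rewrite -[RHS]/(ell1_abscut A x i + (A i)%:R * x i + v i).
by rewrite xE -addrA subrK addrC.
Qed.

Lemma ell1_sum_decomp A x : exists u v,
  [/\ forall i, 0 <= u i, forall i, 0 <= v i,
      forall i, (A i)%:R * x i = u i - v i & ell1_sum A x = `|u| - `|v| ].
Proof.
exists (ell1_abscut A x + ell1_cut A x), (ell1_abscut A x); split => // i.
- by rewrite -[X in 0 <= X]mulrDr mulr_ge0 ?ler0n// -lerBlDr sub0r ler_normr lexx orbT.
- by rewrite mulr_ge0 ?ler0n.
- by rewrite -[RHS]/(ell1_abscut A x i + (A i)%:R * x i - ell1_abscut A x i) addrC addKr.
Qed.

Lemma ell1_sumD A x y : ell1_sum A (x + y) = ell1_sum A x + ell1_sum A y.
Proof.
have [u [v [u0 v0 xE ->]]] := ell1_sum_decomp A x.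
have [u' [v' [u'0 v'0 yE ->]]] := ell1_sum_decomp A y.
rewrite (ell1_sumE A _ (u + u') (v + v')).
- by rewrite !ell1_normD_ge0 // opprD addrACA.
- by move=> i; exact: (addr_ge0 (u0 i) (u'0 i)).
- by move=> i; exact: (addr_ge0 (v0 i) (v'0 i)).
- by move=> i; rewrite mulrDr xE yE opprD addrACA.
Qed.

Lemma ell1_sumZ A (a : R) x : ell1_sum A (a *: x) = a * ell1_sum A x.
Proof.
have [u [v [u0 v0 xE ->]]] := ell1_sum_decomp A x.
have [a0|a0] := leP 0 a; last have na0 : 0 <= - a by rewrite oppr_ge0 ltW.
  rewrite (ell1_sumE A _ (a *: u) (a *: v)).
  - by rewrite !normrZ ger0_norm// mulrBr.
  - by move=> i; exact: (mulr_ge0 a0 (u0 i)).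
  - by move=> i; exact: (mulr_ge0 a0 (v0 i)).
  - by move=> i; rewrite mulrCA xE mulrBr.
(* A negative factor exchanges the roles of [u] and [v]. *)
rewrite (ell1_sumE A _ (- a *: v) (- a *: u)).
- by rewrite !normrZ normrN ltr0_norm// mulrBr !mulNr opprK addrC.
- by move=> i; exact: (mulr_ge0 na0 (v0 i)).
- by move=> i; exact: (mulr_ge0 na0 (u0 i)).
- by move=> i; rewrite mulrCA xE mulrBr -[RHS]/(- a * v i - - a * u i) !mulNr opprK addrC.
Qed.

Lemma ell1_sum0 A : ell1_sum A 0 = 0.
Proof. by rewrite -(scale0r (0 : ell1 R I)) ell1_sumZ mul0r. Qed.

(** By the reverse triangle inequality only the norm of [ell1_cut A x] remains. *)
Lemma ell1_sum_le A x : `|ell1_sum A x| <= `|x|.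
Proof.
rewrite /ell1_sum; apply: le_trans (ler_dist_dist _ _) _.
rewrite addrC addKr; exact/ell1_norm_mono/ell1_cut_subproof.
Qed.

Lemma ell1_delta_esum k : (\esum_(i in [set: I]) `|(i == k)%:R : R|%:E = 1)%E.
Proof.
rewrite -[RHS](@esum_set1 R I k (cst 1%E)) // [RHS]esum_mkcond.
by apply: eq_esum => i _; rewrite in_set1 normr_nat; case: eqP.
Qed.

Lemma ell1_delta_subproof k : (fun i => (i == k)%:R : R) \in @ell1_pred R I.
Proof. by rewrite inE /summable ell1_delta_esum ltry. Qed.

Definition ell1_delta k : ell1 R I := Ell1 (ell1_delta_subproof k).

Lemma ell1_norm_delta k : `|ell1_delta k| = 1.
Proof. by rewrite ell1_normE ell1_delta_esum. Qed.

Lemma ell1_sum_delta A k : ell1_sum A (ell1_delta k) = (A k)%:R.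
Proof.
rewrite (ell1_sumE A _ ((A k)%:R *: ell1_delta k) 0).
- by rewrite normr0 subr0 normrZ ell1_norm_delta mulr1 normr_nat.
- by move=> i; rewrite mulr_ge0 ?ler0n.
- by [].
- move=> i; rewrite -[RHS]/((A k)%:R * (i == k)%:R - 0) subr0 /=.
  by case: eqP => [->//|_]; rewrite !mulr0.
Qed.

End ell1_sum.

(** * The subspace [Y] and the operator [T] for a sequence of index sets *)

Section null_sum_operator.
Variables (R : realType) (I : choiceType) (A : nat -> I -> bool).

Definition null_sums : {pred ell1 R I} :=
  [pred x | `[< ell1_sum R I (A n) x @[n --> \oo] --> (0 : R) >]].

Lemma null_sums_submod_closed : submod_closed null_sums.
Proof.
split=> [|a x y /asboolP x0 /asboolP y0]; apply/asboolP.
  by under eq_fun do rewrite ell1_sum0; exact: cvg_cst.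
under eq_fun do rewrite ell1_sumD ell1_sumZ.
have -> : 0 = a * 0 + 0 :> R by rewrite mulr0 addr0.
by apply: cvgD => //; apply: cvgMr.
Qed.

HB.instance Definition _ :=
  GRing.isSubmodClosed.Build _ _ null_sums null_sums_submod_closed.

(** The functionals are 1-Lipschitz uniformly in [n], so an [e / 2]-close [y] with null sums
    controls the sums of [x]. *)
Lemma closed_null_sums : closed [set x : ell1 R I | x \in null_sums].
Proof.
move=> x xcl; apply/asboolP/cvgrPdist_lt => e e0.
have e20 : 0 < e / 2 by rewrite divr_gt0.
have [y [/asboolP/cvgrPdist_lt/(_ _ e20) y0 xy]] := xcl _ (nbhsx_ballx x _ e20).
apply: filterS y0 => n; rewrite !sub0r !normrN => yn.
rewrite -(subrK y x) ell1_sumD (le_lt_trans (ler_normD _ _))// (splitr e).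
by rewrite ltrD// (le_lt_trans (ell1_sum_le _ _ _ _))// -ball_normE.
Qed.

Lemma null_sums_c0_subproof (y : subspace_type null_sums) :
  (fun n => ell1_sum R I (A n) (val y)) \in @c0_pred R.
Proof. exact: (valP y). Qed.

Definition null_sums_c0 (y : subspace_type null_sums) : c0 R :=
  C0 (null_sums_c0_subproof y).

Lemma null_sums_c0_linear : linear null_sums_c0.
Proof.
move=> a x y; apply/val_inj/funext => n.
by rewrite /= ell1_sumD ell1_sumZ.
Qed.

HB.instance Definition _ := GRing.isLinear.Build R (subspace_type null_sums)
  (c0 R) _ null_sums_c0 null_sums_c0_linear.

Lemma bounded_null_sums_c0 : bounded_fun_norm null_sums_c0.
Proof.
move=> r; exists r => y yr; apply: le_trans yr.
by apply: c0_norm_le => n; exact: ell1_sum_le.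
Qed.

End null_sum_operator.

(** * Countable supports and the contradiction *)

(** Bounded finite sums leave only finitely many points of [J] with [e < g x] or [e < - g x]; the
    levels [1 / (m + 1)] exhaust the support. *)
Lemma countable_support (R : realType) (T : choiceType) (J : set T)
    (g : T -> R) (C : R) :
  (forall s, uniq s -> {in s, forall x, J x} -> `|\sum_(x <- s) g x| <= C) ->
  countable [set x | J x /\ g x <> 0].
Proof.
move=> gC.
have C0 : 0 <= C by have := gC [::] isT; rewrite big_nil normr0; apply.
have fin (f : T -> R) e : 0 < e ->
    (forall s, uniq s -> {in s, forall x, J x} -> `|\sum_(x <- s) f x| <= C) ->
    finite_set [set x | J x /\ e < f x].
  move=> e0 fC; apply: contrapT.
  (* More than [C / e] points of value above [e] already sum to more than [C]. *)
  move=> /(infinite_set_fset (Num.truncn (C / e)).+1)[B BJ cardB].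
  have /(fC _ (fset_uniq B)) : {in enum_fset B, forall x, J x}.
    by move=> x /BJ[].
  apply/negP; rewrite -ltNge (lt_le_trans _ (ler_norm _))//.
  apply: (@lt_le_trans _ _ (\sum_(x <- B) e)).
    rewrite big_const_seq count_predT iter_addr_0 -mulr_natl -ltr_pdivrMr//.
    by rewrite (lt_le_trans (truncnS_gt _))// ler_nat.
  by rewrite !big_seq; apply: ler_sum => x /BJ[_ /ltW].
apply: (@sub_countable _ _ _
    (\bigcup_m [set x | J x /\ m.+1%:R^-1 < `|g x|])).
  apply: subset_card_le => x [Jx /eqP]; rewrite -normr_gt0 => gx.
  have [m] := ltr_add_invr gx; rewrite add0r => mx.
  by exists m.
apply: bigcup_countable => // m _; apply: finite_set_countable.
have m0 : 0 < m.+1%:R^-1 :> R by rewrite invr_gt0.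
have gNC s : uniq s -> {in s, forall x, J x} -> `|\sum_(x <- s) - g x| <= C.
  by move=> us sJ; rewrite sumrN normrN gC.
have : finite_set ([set x | J x /\ m.+1%:R^-1 < g x] `|`
    [set x | J x /\ m.+1%:R^-1 < - g x]).
  by rewrite finite_setU; split; exact: fin.
apply: sub_finite_set => x [Jx].
by rewrite ltr_normr => /orP[] xm; [left|right].
Qed.

Lemma c0_sum_apply (R : realType) (T : Type) (s : seq T) (F : T -> c0 R) n :
  (\sum_(x <- s) F x) n = \sum_(x <- s) F x n.
Proof. by elim: s => [|x s IH]; rewrite ?big_nil// !big_cons -IH. Qed.

Theorem proposition2p8 (R : realType) (I : choiceType)
    (I_uncountable : ~ countable [set: I]) :
  ~ c0_extension_property (ell1 R I).
Proof.
have [J [P [Junc Psurj]]] := uncountable_seq_surj I I_uncountable.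
(* Row [n] of [Q]: the indices whose list has a branch containing [n]. *)
pose A n k := has (branch^~ n) (P k).
move=> /(_ _ (@closed_null_sums R I A) _ (@bounded_null_sums_c0 R I A)).
case=> T' T'bnd T'E.
have [M T'M] := T'bnd 1.
have /choice[k kP] : forall x, exists k, J x -> P k = [:: x].
  move=> x; have [Jx|nJx] := pselect (J x).
    by have [|k <-] := Psurj [:: x]; [move=> y; rewrite inE => /eqP->|exists k].
  have [k _] := Psurj [::] (fun _ h => ltac:(by [])).
  by exists k.
(* For [x] in [J], this is coordinate [n] of [Q - T'] at the unit vector of [k x]. *)
pose g n x : R := (branch x n)%:R - T' (ell1_delta R I (k x)) n.
have gM n s : uniq s -> {in s, forall x, J x} ->
    `|\sum_(x <- s) g n x| <= 1 + M.
  move=> us sJ; have [l Pl] := Psurj s sJ.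
  pose z := ell1_delta R I l - \sum_(x <- s) ell1_delta R I (k x).
  have sumz m : ell1_sum R I (A m) z =
      (has (branch^~ m) s)%:R - \sum_(x <- s) (branch x m)%:R.
    rewrite /z ell1_sumD -scaleN1r ell1_sumZ mulN1r ell1_sum_delta /A Pl.
    congr (_ - _); elim: s sJ {us Pl z} => [|x s IH] sJ.
      by rewrite !big_nil ell1_sum0.
    rewrite !big_cons ell1_sumD ell1_sum_delta kP /= ?orbF;
      last exact/sJ/mem_head.
    by rewrite IH// => y ys; apply: sJ; rewrite inE ys orbT.
  have zY : z \in null_sums R I A.
    apply/asboolP; under eq_fun do rewrite sumz.
    apply: cvg_near_cst; have := has_branch_sum R _ us.
    by apply: filterS => m ->; rewrite subrr.
  have := congr1 (fun u : c0 R => u n) (T'E (SubspaceType zY)).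
  rewrite /= sumz /z raddfB raddf_sum => TE.
  have sumTE :
      T' (ell1_delta R I l) n - \sum_(x <- s) T' (ell1_delta R I (k x)) n =
      (has (branch^~ n) s)%:R - \sum_(x <- s) (branch x n)%:R.
    by rewrite -TE -c0_sum_apply.
  have branchE : \sum_(x <- s) (branch x n)%:R = (has (branch^~ n) s)%:R -
      (T' (ell1_delta R I l) n - \sum_(x <- s) T' (ell1_delta R I (k x)) n).
    by rewrite sumTE subKr.
  (* What remains is coordinate [n] of [Q - T'] at the unit vector of [l]: an indicator value minus
     a number of modulus at most [M]. *)
  rewrite sumrB branchE opprB addrA addrAC addrK (le_trans (ler_normB _ _))//.
  rewrite lerD ?normr_nat ?lern1 ?leq_b1//.
  by rewrite (le_trans (c0_norm_ub _ n))// T'M// ell1_norm_delta.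
have suppc n := countable_support R _ J (g n) _ (gM n).
have [x [Jx gx]] : exists x, J x /\ forall n, g n x = 0.
  apply: contrapT => nex; apply: Junc.
  apply: (@sub_countable _ _ _ (\bigcup_n [set x | J x /\ g n x <> 0])).
    apply: subset_card_le => x Jx; apply: contrapT => nx; apply: nex.
    exists x; split=> // n; apply: contrapT => gx; apply: nx.
    by exists n.
  by apply: bigcup_countable => // n _; exact: suppc.
(* From [N] on this null sequence is below 1 in modulus, yet it equals 1 on the branch of [x], which
   would thus lie below [N]. *)
have /cvgrPdist_lt/(_ _ ltr01)[N _ NP] := c0_cvg (T' (ell1_delta R I (k x))).
apply: (@branch_infinite x); apply: (sub_finite_set _ (finite_II N)) => n /= xn.
rewrite ltnNge; apply/negP => /NP /=; have /eqP := gx n.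
rewrite /g subr_eq0 => /eqP <-.
by rewrite xn sub0r normrN normr1 ltxx.
Qed.
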